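(* Let $M$ and $N$ be positive integers with $M>N$, and let $v$ be an integer between $1$ and $M-N$. Let $P=\{p_{v+1},\ldots,p_{v+N}\}$ be a Motzkin partition of $N$ and let $T=\{t_1,\ldots,t_M\}$ be a partition of $M$ into $M$ parts such that (1) $t_i\ge p_i$ for all $v+1\le i\le v+N$; (2) $\sum_{k=1}^i t_k\le i$ for all $i$; (3) $\sum_{k=1}^i t_k<i$ for all $1\le i<v+N$. Then there exist adjacency sets $S_i\subseteq\{1,\dots,i-1\}$ of size $t_i$, for $1<i\le M$, such that the digraph $D$ resulting from the iterative construction process has $M$ vertices, $M$ edges, and a single undirected cycle of length $N$ on vertices $v+1$ through $v+N$.
   Context: A ''partition of $M$ into $M$ parts'' here means an ordered sequence $(t_1,\dots,t_M)$ of non-negative integers (zero parts are allowed) with $\sum_{i=1}^M t_i=M$. A Motzkin partition of a positive integer $N$ is a partition $(p_1,\ldots,p_N)$ of $N$ into exactly $N$ parts (in the same sense) such that $0\le p_i\le 2$ for all $i$ and $\sum_{k=1}^i p_k<i$ for all $i<N$. In the claim its entries are indexed by $v+1,\dots,v+N$ in place of $1,\dots,N$. Iterative construction process: start with the digraph $D_1$ consisting of the single vertex $1$; for $i=2,\dots,M$ let $D_i$ be obtained from $D_{i-1}$ by adding a new vertex $i$ and the directed edges $s\to i$ for all $s\in S_i$, where $S_i\subseteq\{1,\dots,i-1\}$ is the $i$-th adjacency set. The resulting digraph is $D=D_M$. ''Undirected cycle'' means a cycle in the underlying undirected graph.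
   Formalization: The formal theorem assumes N ≥ 3 instead of N ≥ 1: since S_i is a subset of {1,…,i−1}, the underlying graph is simple and has no cycle of length 1 or 2, so the claim fails for N = 1, 2 (e.g. N=2, M=3, v=1, P=(0,2), T=(0,0,3)). *)

(* Defs.v *)
From mathcomp Require Import all_boot.
From mathcomp Require Import finmap.

Set Implicit Arguments.
Unset Strict Implicit.
Unset Printing Implicit Defensive.

Local Open Scope fset_scope.
Local Open Scope nat_scope.

(* A sequence (t_1, ..., t_n) of non-negative integers is a function on nat of
   which only the values at 1, ..., n are used. *)
Definition partition_into (n : nat) (t : nat -> nat) : Prop :=
  \sum_(1 <= k < n.+1) t k = n.

Definition motzkin_partition (n : nat) (p : nat -> nat) : Prop :=
  [/\ partition_into n p,
      forall i, 1 <= i <= n -> p i <= 2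
    & forall i, 1 <= i < n -> \sum_(1 <= k < i.+1) p k < i].

(* (x, y) \in edges D is the directed edge x -> y. *)
Record digraph := Digraph {
  vertices : {fset nat};
  edges : {fset nat * nat}
}.

Definition add_vertex (D : digraph) (i : nat) (A : {fset nat}) : digraph :=
  Digraph (i |` vertices D) (edges D `|` [fset (s, i) | s in A]).

(* [construction S i] is D_i. There is no adjacency set for vertex 1, so S 1
   is not used; D_0 is a dummy value. *)
Fixpoint construction (S : nat -> {fset nat}) (i : nat) : digraph :=
  match i with
  | 0 => Digraph fset0 fset0
  | 1 => Digraph [fset 1] fset0
  | j.+1 => add_vertex (construction S j) j.+1 (S j.+1)
  end.

Definition adjacent (D : digraph) : rel nat :=
  fun x y => ((x, y) \in edges D) || ((y, x) \in edges D).

(* Without [2 < size c], going back and forth along an edge would count. *)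
Definition undirected_cycle (D : digraph) (c : seq nat) : bool :=
  [&& 2 < size c, uniq c & cycle (adjacent D) c].

(* Two vertex sequences describe the same undirected cycle iff they differ by
   the choice of starting point and direction. *)
Definition same_cycle (c c' : seq nat) : Prop :=
  exists n, c' = rot n c \/ c' = rot n (rev c).

(* Main.v *)
Require Import Defs.
From mathcomp Require Import all_boot.
From mathcomp Require Import finmap.
From mathcomp Require Import zify.

Set Implicit Arguments.
Unset Strict Implicit.
Unset Printing Implicit Defensive.

Local Open Scope fset_scope.
Local Open Scope nat_scope.

(** The in-degrees are split as t = p + q, where p is used only on the vertices
    v+1, ..., v+N, and the two parts are realised independently.

    The p-part produces the cycle.  A Motzkin partition is exactly the sequence
    of in-degrees met when a cycle is assembled from paths: a new vertex with
    p = 0 starts a path of its own, one with p = 1 is put at the end of a path,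
    and one with p = 2 joins the ends of two paths.  After k vertices there are
    k - (p_1 + ... + p_k) paths, so the strict inequalities of a Motzkin
    partition say that a path is always left and that two are available whenever
    p = 2; the last vertex finds a single path and closes it up.  This is
    [motzkin_cycle].

    The q-part hangs trees on that cycle.  Let the whole cycle count as the one
    vertex v+N, and list the remaining vertices in increasing order:
    1, ..., v, v+N, ..., M.  Vertex i receives edges from the next q_i members
    of this queue that have not been used yet.  Each member then has at most one
    outgoing tree edge, and the bounds on the prefix sums of t say that the
    members taken at step i precede i: up to v the prefix sum of q is less than
    i, at the cycle vertices it is at most (v + N) - N = v, and afterwards it is
    at most i - N, the number of members that precede i.

    Nothing but the cycle is closed: a tree edge u -> i is a bridge, because it
    is the only edge leaving the set of the vertices whose chain of tree edges
    passes through u ([cycle_in_block]).  An undirected cycle therefore uses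
    cycle edges alone, and a cycle whose steps all join neighbours on a given
    cycle is that cycle up to rotation and reversal ([same_cycle_of_steps]). *)

(** * Cycles inside a cycle *)

Lemma fpath_first_visit (T : eqType) (f : T -> T) x y r r' :
    fpath f y (rcons r x) -> fpath f y (rcons r' x) ->
  x \notin r -> x \notin r' -> r = r'.
Proof.
elim: r y r' => [|z r IHr] y [|z' r'] //=.
- by move=> /andP[/eqP-> _] /andP[/eqP-> _] _; rewrite mem_head.
- by move=> /andP[/eqP-> _] /andP[/eqP-> _]; rewrite mem_head.
move=> /andP[/eqP<- Pr] /andP[/eqP<- Pr']; rewrite !inE !negb_or.
by move=> /andP[_ xr] /andP[_ xr']; rewrite (IHr _ r' Pr).
Qed.

Lemma fcycle_rot (T : eqType) (f : T -> T) c c' x :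
  uniq c -> uniq c' -> fcycle f c -> fcycle f c' -> x \in c -> x \in c' ->
  exists n, c' = rot n c.
Proof.
move=> Uc Uc' Fc Fc' /rot_to[i s Es] /rot_to[i' s' Es'].
suff ss : s = s'.
  exists (rot_add c i (size c' - i')).
  by rewrite -rot_rot_add Es ss -Es' -[LHS](rotK i') /rotr size_rot.
move: Uc Uc' Fc Fc'; rewrite -(rot_uniq i) -(rot_uniq i' c') Es Es'.
rewrite -(rot_cycle i) Es -(rot_cycle i' _ c') Es' /=.
move=> /andP[xs _] /andP[xs' _].
by move=> Fs Fs'; apply: fpath_first_visit Fs Fs' xs xs'.
Qed.

(** Being unable to turn back, a simple path inside a cycle keeps the direction
    of its first step. *)
Lemma path_follows_next (T : eqType) (c : seq T) a b s :
    uniq c -> uniq (a :: b :: s) -> b = next c a ->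
    path (fun x y => (y == next c x) || (x == next c y)) b s ->
  fpath (next c) b s.
Proof.
move=> Uc; elim: s a b => //= d s IHs a b.
rewrite !inE !negb_or -!andbA => /and5P[ab ad a_s bd /and3P[b_s d_s Us]] bE.
case/andP=> /orP[/eqP dE | /eqP bE'] ds; last first.
  by case/eqP: ad; rewrite -(prev_next Uc a) -bE bE' prev_next.
rewrite dE eqxx /= -dE; apply: (IHs b) => //=.
by rewrite !inE negb_or bd b_s d_s Us.
Qed.

(** The condition on s rules out the walk back and forth along one edge, whose
    closing step goes in the direction opposite to its first one. *)
Lemma fcycle_next_of_first_step (T : eqType) (c : seq T) a b s :
    uniq c -> uniq (a :: b :: s) -> s != [::] -> b = next c a ->
    cycle (fun x y => (y == next c x) || (x == next c y)) (a :: b :: s) ->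
  fcycle (next c) (a :: b :: s).
Proof.
move=> Uc Us s0 bE; rewrite /= !rcons_path => /and3P[_ bs cl].
rewrite -{1}bE eqxx /= (path_follows_next Uc Us) //=.
case/orP: cl => [/eqP <- // | /eqP lE].
move: Us s0; rewrite -bE in lE; case: s bs lE => //= d s _ lE.
by rewrite -{2}lE mem_last andbF.
Qed.

(** The first step of c' goes along c or against it; in the second case the
    reversal of c' goes along c. Two cycles of the same successor function that
    share a vertex are rotations of each other. *)
Lemma same_cycle_of_steps c c' :
    uniq c -> uniq c' -> 2 < size c' -> {subset c' <= c} ->
    cycle (fun x y => (y == next c x) || (x == next c y)) c' ->
  same_cycle c c'.
Proof.
move=> Uc; set e := (e in cycle e _).
have e_sym x y : e x y = e y x by rewrite /e orbC.
case: c' => [|a [|b s]] // Us size_s sub_c Cs.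
have s0 : s != [::] by case: s size_s {Us sub_c Cs}.
have a_c : a \in c by apply: sub_c; rewrite mem_head.
have := Cs; rewrite /= => /andP[/orP[]/eqP abE _].
  have [n ->] := fcycle_rot Uc Us (cycle_next Uc)
    (fcycle_next_of_first_step Uc Us s0 abE Cs) a_c (mem_head _ _).
  by exists n; left.
have revE : rot (size s) (rev (a :: b :: s)) = b :: a :: rev s.
  by rewrite !rev_cons -!cats1 -catA -(size_rev s) rot_size_cat.
have Us' : uniq (b :: a :: rev s) by rewrite -revE rot_uniq rev_uniq.
have Cs' : cycle e (b :: a :: rev s).
  rewrite -revE rot_cycle rev_cycle; apply: sub_cycle Cs => x y.
  by rewrite e_sym.
have a_in : a \in b :: a :: rev s by rewrite !inE eqxx orbT.
have rs0 : rev s != [::] by rewrite -size_eq0 size_rev size_eq0.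
have [n nE] := fcycle_rot Uc Us' (cycle_next Uc)
    (fcycle_next_of_first_step Uc Us' rs0 abE Cs') a_c a_in.
exists (rot_add (rev c) (size (rev c) - n) (size s)); right.
rewrite -rot_rot_add -[rot (_ - n) _]/(rotr n _) -rev_rot -nE -revE.
by rewrite -rev_rotr rotK revK.
Qed.

(** * Tree edges are bridges *)

Lemma path_invariant (T : Type) (e : rel T) (K : T -> Prop) x s :
  (forall a b, e a b -> (K a <-> K b)) -> path e x s -> (K x <-> K (last x s)).
Proof.
move=> eK; elim: s x => //= y s IHs x /andP[/eK-> /IHs]; exact.
Qed.

(** The rest of the cycle is a path between the ends of the edge x -- next c x
    that does not use this edge. So an edge that is alone in crossing the cut K
    lies on no cycle. *)
Lemma cycle_avoids_bridge (T : eqType) (e : rel T) (K : T -> Prop) c x :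
    uniq c -> 2 < size c -> cycle e c -> x \in c ->
    (forall a b, e a b -> (a, b) != (x, next c x) -> (a, b) != (next c x, x) ->
       (K a <-> K b)) ->
  (K x <-> K (next c x)).
Proof.
move=> Uc sz_c Cc /rot_to[i s Ec].
rewrite -(next_rot i) // Ec; move: Uc sz_c Cc.
rewrite -(rot_uniq i) -(size_rot i) -(rot_cycle i) Ec.
case: s {Ec} => [|y [|z s]] // Us _; rewrite /= eqxx.
case/and3P=> _ eyz Pz eK.
(* The cycle is x, y, z :: s; its part y, z :: s, x avoids the edge x y. *)
set e' : rel T := fun a b => [&& e a b, (a, b) != (x, y) & (a, b) != (y, x)].
have e'K a b : e' a b -> (K a <-> K b) by case/and3P=> *; apply: eK.
suff Ps : path e' y (z :: rcons s x).
  by rewrite (path_invariant e'K Ps) /= last_rcons.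
move: Us; rewrite /= !inE !negb_or -!andbA.
case/and5P=> xy xz x_s yz /and3P[y_s _ _].
rewrite /= /e' eyz !xpair_eqE !(eq_sym y x) !(eq_sym z x).
rewrite (negbTE xy) (negbTE xz) andbF /=.
move: yz Pz; elim: s z x_s y_s {eyz xz eK} => [|w s IHs] z x_s y_s yz /=.
  by rewrite !xpair_eqE !(eq_sym z y) (negbTE yz) (negbTE xy) !andbF !andbT.
case/andP=> ezw Pw; move: x_s y_s; rewrite !inE !negb_or.
case/andP=> xw x_s /andP[yw y_s]; rewrite (IHs w) // ezw !xpair_eqE.
by rewrite (eq_sym w y) (negbTE yw) (eq_sym w x) (negbTE xw) !andbF.
Qed.

(** The set of y that reach u along tree edges once the block B is contracted to
    its vertex b. It is the cut that isolates the tree edge leaving u. *)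
Inductive descends (tree : rel nat) (B : pred nat) (b u : nat) : nat -> Prop :=
| DescRefl : descends tree B b u u
| DescEdge y z : tree y z -> descends tree B b u z -> descends tree B b u y
| DescBlock y : B y -> y != b -> descends tree B b u b -> descends tree B b u y.

(** Contracting B to b turns the graph into an increasing forest, since tree
    edges leave B at b only; so every cycle stays inside B. Indeed the tree edge
    leaving u is the only edge that crosses the cut [descends _ _ _ u], so it is
    a bridge. *)
Lemma cycle_in_block (tree : rel nat) (B : pred nat) (b : nat) (e : rel nat) c :
    (forall y z, tree y z -> y < z) ->
    (forall y z z', tree y z -> tree y z' -> z = z') ->
    (forall y, B y -> y <= b) ->
    (forall y z, B y -> tree y z -> y = b) ->
    (forall x y, e x y -> [|| tree x y, tree y x | B x && B y]) ->
    uniq c -> 2 < size c -> cycle e c ->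
  cycle (fun x y => [&& e x y, B x & B y]) c.
Proof.
move=> tree_lt tree_fun B_le B_out eP Uc sz_c Cc.
pose desc := descends tree B b.
have desc_le u y : desc u y -> y <= u.
  elim=> {y} // [y z /tree_lt lt_yz _ /(leq_trans _)-> // | y By _ _].
    exact: ltnW.
  exact/leq_trans/B_le.
have desc_tree u y z : tree y z -> y != u -> (desc u y <-> desc u z).
  move=> Tyz yu; split=> [Dy|]; last exact: DescEdge.
  case: Dy Tyz yu => [|y' z' T' D' T'' _|y' By nyb _ T' _]; rewrite ?eqxx //.
    by rewrite (tree_fun _ _ _ T'' T').
  by case/eqP: nyb; apply: B_out T'.
have desc_block u i x : tree u i -> B x -> (desc u x <-> desc u b).
  move=> Tui Bx; split=> [Dx|Db]; last first.
    by case: (eqVneq x b) => [-> // | nxb]; apply: DescBlock.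
  case: Dx Bx Tui => [|y z Tyz Dz By _|//] => [Bu /(B_out _ _ Bu)<-|].
    exact: DescRefl.
  by rewrite -(B_out _ _ By Tyz); apply: DescEdge Tyz Dz.
have bridge u i : tree u i ->
    forall x, x \in c -> (x, next c x) != (u, i) /\ (next c x, x) != (u, i).
  move=> Tui x xc; apply/andP; rewrite -negb_or; apply/negP => ux.
  have eK a a' : e a a' ->
      (a, a') != (x, next c x) -> (a, a') != (next c x, x) ->
      (desc u a <-> desc u a').
    move=> /eP/or3P[Ta | Ta | /andP[Ba Ba']] n1 n2.
    - apply: (desc_tree _ _ _ Ta); apply/eqP => au.
      have a'i : a' = i by apply: tree_fun Ta _; rewrite au.
      by move: ux n1 n2; rewrite au a'i => /orP[]/eqP->; rewrite eqxx.
    - apply: iff_sym; apply: (desc_tree _ _ _ Ta); apply/eqP => a'u.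
      have ai : a = i by apply: tree_fun Ta _; rewrite a'u.
      move: ux n1 n2; rewrite a'u ai !xpair_eqE.
      by case/orP=> /andP[/eqP-> /eqP->]; rewrite !eqxx.
    - by rewrite !(desc_block _ _ _ Tui).
  have Du : desc u u by apply: DescRefl.
  have nDi : ~ desc u i by move/desc_le; rewrite leqNgt tree_lt.
  have [to fro] := cycle_avoids_bridge Uc sz_c Cc xc eK.
  case/orP: ux => /eqP[E1 E2]; move: to fro.
    by rewrite E2 E1; tauto.
  by rewrite E1 E2; tauto.
apply: cycle_from_next => // x xc; have ex := next_cycle Cc xc.
rewrite ex; case/or3P: (eP _ _ ex) => // Te.
  by case: (bridge _ _ Te _ xc); rewrite eqxx.
by case: (bridge _ _ Te _ xc) => _; rewrite eqxx.
Qed.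

(** * Assembling a cycle from a Motzkin partition *)

Definition steps (T : Type) (s : seq T) : seq (T * T) := zip s (behead s).

Lemma steps_cat (T : Type) (x y : T) s s' :
  steps ((x :: s) ++ y :: s') =
  steps (x :: s) ++ (last x s, y) :: steps (y :: s').
Proof. by elim: s x => //= z s IHs x; rewrite -cat_cons -IHs. Qed.

Lemma path_steps (T : Type) (e : rel T) x s :
  path e x s = all (fun q => e q.1 q.2) (steps (x :: s)).
Proof. by elim: s x => //= y s IHs x; rewrite IHs. Qed.

(** The paths after k vertices, each written as the word of its vertices. The
    newest word is at the head and only the first two words are ever extended.
    The last branch, where too few words are left, is excluded by the Motzkin
    condition. *)
Fixpoint words (v : nat) (p : nat -> nat) (j : nat) : seq (seq nat) :=
  if j is k.+1 then
    let x := v + k.+1 in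
    match p x, words v p k with
    | 0, W => [:: x] :: W
    | 1, w :: W => (x :: w) :: W
    | _, w :: w' :: W => (w ++ x :: w') :: W
    | _, W => W
    end
  else [::].

(** The vertices to which v+k+1 is linked when it is added. The default value of
    [head w W] is w itself: when a single word is left, its two ends are
    returned, so the same formula also closes the cycle. *)
Definition attached_ends (v : nat) (p : nat -> nat) (k : nat) : seq nat :=
  match p (v + k.+1), words v p k with
  | 0, _ | _, [::] => [::]
  | 1, w :: _ => [:: head 0 w]
  | _, w :: W => [:: last 0 w; head 0 (head w W)]
  end.

Definition word_steps (W : seq (seq nat)) : seq (nat * nat) :=
  flatten (map (@steps nat) W).

Definition prefix_sum (f : nat -> nat) (n : nat) : nat :=
  \sum_(1 <= k < n.+1) f k.

Lemma prefix_sum0 f : prefix_sum f 0 = 0.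
Proof. by rewrite /prefix_sum big_geq. Qed.

Lemma prefix_sumS f n : prefix_sum f n.+1 = prefix_sum f n + f n.+1.
Proof. by rewrite /prefix_sum big_nat_recr. Qed.

(** Counting words by prefix sums: there are always enough of them for the step
    prescribed by p. *)
Lemma motzkin_step v p N k (W := words v p k) :
    motzkin_partition N (fun k => p (v + k)) -> k.+1 < N ->
    size W + prefix_sum (fun i => p (v + i)) k = k ->
  [\/ p (v + k.+1) = 0,
      p (v + k.+1) = 1 /\ (exists w W', W = w :: W')
    | p (v + k.+1) = 2 /\ (exists w w' W', W = [:: w, w' & W'])].
Proof.
case=> _ p_le2 p_lt kN szW.
have := p_le2 k.+1; have := p_lt k.+1 kN.
rewrite -/(prefix_sum _ _) prefix_sumS; move: szW.
case pk: (p (v + k.+1)) => [|[|[|n]]]; last by lia.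
- by constructor 1.
- by case: W => [|w W'] /=; [lia | constructor 2; split=> //; exists w, W'].
- case: W => [|w [|w' W']] /=; try lia.
  by constructor 3; split=> //; exists w, w', W'.
Qed.

Lemma words_inv v p N k (W := words v p k) :
    motzkin_partition N (fun k => p (v + k)) -> k < N ->
  [/\ size W + prefix_sum (fun i => p (v + i)) k = k, [::] \notin W
    & perm_eq (flatten W) (iota v.+1 k)].
Proof.
move=> mp; rewrite {}/W; elim: k => [|k IHk] kN; first by rewrite prefix_sum0.
have [szW ne pW] := IHk (ltnW kN).
have -> : iota v.+1 k.+1 = rcons (iota v.+1 k) (v + k.+1).
  by rewrite -cats1 -addSnnS -(iotaD v.+1 k 1) addn1.
have := motzkin_step mp kN szW; rewrite prefix_sumS /=.
case=> [-> | [-> [w [W' EW]]] | [-> [w [w' [W' EW]]]]].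
- split; [rewrite /=; lia | by rewrite inE | rewrite /=].
  by rewrite perm_sym perm_rcons perm_cons perm_sym.
- move: szW ne pW; rewrite EW /= !inE !negb_or => szW /andP[_ ne] pW.
  split; [lia | by rewrite ne | rewrite perm_sym perm_rcons perm_cons].
  by rewrite perm_sym.
- move: szW ne pW; rewrite EW /= !inE !negb_or => szW /and3P[_ _ ne] pW.
  split; [lia | by rewrite ne andbT; case: (w) | ].
  rewrite -catA /= -[_ :: w' ++ _]cat1s perm_catCA /=.
  by rewrite perm_sym perm_rcons perm_cons perm_sym.
Qed.

(** Before the last vertex the prefix sum is at most N-2, and one part of at
    most 2 must bring it to N, so the last part is 2 and exactly one word is
    left. *)
Lemma last_word v p n :
    motzkin_partition n.+2 (fun k => p (v + k)) ->
  p (v + n.+2) = 2 /\ exists w, words v p n.+1 = [:: w].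
Proof.
move=> mp; have [szW _ _] := words_inv mp (ltnSn _).
case: mp; rewrite /partition_into -/(prefix_sum _ _) prefix_sumS => sum_p.
move=> /(_ n.+2); rewrite leqnn => /(_ isT) p_le2.
move=> /(_ n.+1); rewrite ltnSn => /(_ isT).
rewrite -/(prefix_sum _ _) => sum_lt.
split; first by lia.
by case: (words _ _ _) szW => [|w [|w' W]] /=; [lia | exists w | lia].
Qed.

(** The two ends are distinct when p = 2: they belong to different words or, at
    the last vertex, to one word with N-1 > 1 letters. *)
Lemma attached_ends_spec v p N k :
    motzkin_partition N (fun k => p (v + k)) -> 2 < N -> k < N ->
  [/\ size (attached_ends v p k) = p (v + k.+1), uniq (attached_ends v p k)
    & {subset attached_ends v p k <= iota v.+1 k}].
Proof.
move=> mp N2 kN; have [szW ne pW] := words_inv mp kN.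
suff [sz_j u_j j_sub] : [/\ size (attached_ends v p k) = p (v + k.+1),
    uniq (attached_ends v p k)
    & {subset attached_ends v p k <= flatten (words v p k)}].
  by split=> // x /j_sub; rewrite (perm_mem pW).
have uW : uniq (flatten (words v p k)) by rewrite (perm_uniq pW) iota_uniq.
have [kN' | Nk] := ltnP k.+1 N.
  case: (motzkin_step mp kN' szW); rewrite /attached_ends.
  - by move->.
  - case=> -> [w [W' EW]]; move: ne; rewrite EW; case: w {EW} => // a w _.
    by split=> // x; rewrite inE => /eqP->; rewrite /= mem_head.
  - case=> -> [w [w' [W' EW]]]; move: ne uW; rewrite EW.
    case: w w' {EW} => [|a w] // [|b w'] // _.
    have -> : flatten [:: a :: w, b :: w' & W'] =
      (a :: w) ++ (b :: w' ++ flatten W') by [].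
    rewrite cat_uniq => /and3P[_ /hasPn disj _]; have lw := mem_last a w.
    have lb : last a w != b.
      by apply: contraTneq lw => ->; apply/disj/mem_head.
    split=> //; first by rewrite /= inE lb.
    move=> x; rewrite mem_cat mem_seq2 => /orP[]/eqP->; first by rewrite lw.
    by rewrite [head _ _]/= mem_head orbT.
have EN : N = k.+1 by lia.
case: k {kN Nk} => [|k] in EN szW ne pW uW *; first by lia.
rewrite EN in mp; have [pN [w Ew]] := last_word mp.
have sz_w := perm_size pW; move: ne uW sz_w.
rewrite /attached_ends pN Ew size_iota.
case: w {Ew} => [|a w] // _; rewrite [flatten _]/= cats0 => uW sz_w.
case: w => [|b w] in uW sz_w *; first by move: sz_w => /=; lia.
split=> //=.
  move: uW; rewrite /= !inE andbT => /andP[a_w _].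
  by apply: contraNneq a_w => <-; apply: mem_last.
move=> x; rewrite !inE => /orP[]/eqP->; last by rewrite eqxx.
by have := mem_last b w; rewrite inE => ->; rewrite orbT.
Qed.

Lemma word_steps_cons w W : word_steps (w :: W) = steps w ++ word_steps W.
Proof. by []. Qed.

Lemma steps2 (T : Type) (x y : T) s :
  steps [:: x, y & s] = (x, y) :: steps (y :: s).
Proof. by []. Qed.

(** Two vertices are neighbours in a word if and only if one was linked to the
    other, because every new letter is put next to the ends it is linked to and
    separates no earlier neighbours. *)
Lemma word_steps_step v p N k (x y : nat) (z := v + k.+1) :
    motzkin_partition N (fun k => p (v + k)) -> k.+1 < N ->
  let linked W := ((x, y) \in word_steps W) || ((y, x) \in word_steps W) in
  linked (words v p k.+1) = [|| linked (words v p k),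
    (y == z) && (x \in attached_ends v p k)
    | (x == z) && (y \in attached_ends v p k)].
Proof.
move=> mp kN linked; have [szW ne _] := words_inv mp (ltnW kN).
have := motzkin_step mp kN szW; rewrite /attached_ends /= -/z.
case=> [-> | [-> [w [W' EW]]] | [-> [w [w' [W' EW]]]]].
- by rewrite /= !andbF !orbF.
- move: ne; rewrite EW; case: w {EW} => [|a w] // _.
  rewrite /linked !word_steps_cons steps2 !mem_cat /= !inE !xpair_eqE.
  by do !case: (_ == _) => //=; rewrite ?orbT ?orbF.
- move: ne; rewrite EW; case: w w' {EW} => [|a w] // [|b w'] // _.
  rewrite /linked !word_steps_cons steps_cat steps2 [head 0 (head _ _)]/=.
  rewrite [last 0 _]/= !(inE, mem_cat) !xpair_eqE.
  do !case: (_ \in _); rewrite ?orbT //=.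
  by do !case: (_ == _).
Qed.

Definition cycle_in_neighbours v p N y : seq nat :=
  if v < y <= v + N then attached_ends v p (y - v.+1) else [::].

Lemma word_steps_in_neighbours v p N k (x y : nat)
    (C := cycle_in_neighbours v p N) :
    motzkin_partition N (fun k => p (v + k)) -> k < N ->
  ((x, y) \in word_steps (words v p k)) || ((y, x) \in word_steps (words v p k))
  = (y <= v + k) && (x \in C y) || (x <= v + k) && (y \in C x).
Proof.
move=> mp; elim: k => [|k IHk] kN.
  rewrite addn0 /C /cycle_in_neighbours /= !inE.
  by case: (leqP y v) => //=; case: (leqP x v).
rewrite (word_steps_step _ _ mp kN) (IHk (ltnW kN)).
have CE : C (v + k.+1) = attached_ends v p k.
  rewrite /C /cycle_in_neighbours ifT; last by lia.
  by congr attached_ends; lia.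
have stepE (u t : nat) : (u <= v + k.+1) && (t \in C u) =
    (u <= v + k) && (t \in C u) ||
    (u == v + k.+1) && (t \in attached_ends v p k).
  rewrite addnS leq_eqVlt ltnS -addnS.
  case: eqP => [->|_]; rewrite ?CE /= ?orbF //.
  by case: (_ \in _); rewrite ?andbF ?andbT ?orbT.
by rewrite !stepE orbACA.
Qed.

(** The cycle is the last vertex followed by the single word left before it. *)
Lemma motzkin_cycle v p N (C := cycle_in_neighbours v p N) :
    motzkin_partition N (fun k => p (v + k)) -> 2 < N ->
  exists c, [/\ uniq c, size c = N,
    forall x : nat, (x \in c) = (v + 1 <= x <= v + N),
    cycle (fun x y : nat => (x \in C y) || (y \in C x)) c
    & forall x y : nat, x \in C y -> (y == next c x) || (x == next c y)].
Proof.
case: N @C => [|[|n]] // C mp N2; have [pN [w Ew]] := last_word mp.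
have [_ ne pw] := words_inv mp (ltnSn _).
set z := v + n.+2; set c := z :: w.
have w0 : w = head 0 w :: behead w by move: ne; rewrite Ew; case: (w).
move: pw; rewrite Ew [flatten _]/= cats0 => pw.
have memw (x : nat) : (x \in w) = (v + 1 <= x <= v + n.+1).
  by rewrite (perm_mem pw) mem_iota; lia.
have memc (x : nat) : (x \in c) = (v + 1 <= x <= v + n.+2).
  by rewrite inE memw /z; lia.
have uc : uniq c.
  rewrite /c /= memw (perm_uniq pw) iota_uniq andbT; apply/negP; lia.
have Cz : C z = [:: last 0 w; head 0 w].
  rewrite /C /cycle_in_neighbours ifT; last by rewrite /z; lia.
  have -> : z - v.+1 = n.+1 by rewrite /z; lia.
  by rewrite /attached_ends pN Ew.
pose closed_steps := steps (z :: rcons w z).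
have closed_stepsE (x y : nat) :
    ((x, y) \in closed_steps) || ((y, x) \in closed_steps) =
    (x \in C y) || (y \in C x).
  have CE u t : (u \in C t) =
      (t <= v + n.+1) && (u \in C t) || (t == z) && (u \in C z).
    case: (eqVneq t z) => [-> | tz]; last rewrite orbF.
      by case: (_ \in _); rewrite ?andbF ?orbT.
    case: leqP => // t_gt; rewrite /C /cycle_in_neighbours ifF //.
    by apply/negbTE; move: tz; rewrite /z; lia.
  rewrite [x \in C y]CE [y \in C x]CE orbACA
    -(word_steps_in_neighbours _ _ mp) // Cz Ew.
  rewrite /closed_steps {1 2}w0 rcons_cons steps2 -rcons_cons -cats1.
  rewrite steps_cat -w0.
  rewrite /word_steps /= cats0.
  have -> : last 0 w = last (head 0 w) (behead w) by rewrite {1}w0.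
  rewrite !(inE, mem_cat) !xpair_eqE; do !case: (_ \in _); rewrite ?orbT //=.
  by do !case: (_ == _).
exists c; split=> //; first by rewrite /= (perm_size pw) /= size_iota.
  rewrite /= path_steps; apply/allP => -[x y] xy /=.
  by rewrite -closed_stepsE xy.
have next_step (x y : nat) : (x, y) \in closed_steps -> y == next c x.
  have := cycle_next uc; rewrite /= path_steps => /allP nextP xy.
  by have /= := nextP _ xy; rewrite eq_sym.
move=> x y xy; have := closed_stepsE x y; rewrite xy.
by case/orP=> /next_step->; rewrite ?orbT.
Qed.

(** * Vertices and edges of the construction *)

Lemma in_vertices_construction S n x :
  (x \in vertices (construction S n)) = (0 < x <= n).
Proof.
elim: n => [|[|n] IHn]; first by rewrite inE; lia.
  by rewrite inE; lia.
by rewrite in_fset1U IHn; lia.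
Qed.

Lemma card_vertices_construction S n : #|` vertices (construction S n)| = n.
Proof.
elim: n => [|[|n] IHn]; first exact: cardfs0.
  exact: cardfs1.
rewrite -[vertices _]/(n.+2 |` vertices (construction S n.+1)) cardfsU1 IHn.
by rewrite in_vertices_construction ltnn andbF.
Qed.

Lemma in_edges_construction S n x y :
  ((x, y) \in edges (construction S n)) = (1 < y <= n) && (x \in S y).
Proof.
elim: n => [|[|n] IHn]; first by rewrite inE; lia.
  by rewrite inE; lia.
rewrite in_fsetU IHn; have -> : ((x, y) \in [fset (s, n.+2) | s in S n.+2])
    = (y == n.+2) && (x \in S n.+2).
  apply/imfsetP/andP => /= [[s sS [-> ->]] | [/eqP-> xS]].
    by rewrite eqxx.
  by exists x.
case: (eqVneq y n.+2) => [-> | ny]; first by rewrite ltnn andbF /= leqnn.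
by rewrite orbF; congr (_ && _); lia.
Qed.

Lemma card_edges_construction S n :
  #|` edges (construction S n.+1)| = \sum_(2 <= i < n.+2) #|` S i|.
Proof.
elim: n => [|n IHn]; first by rewrite cardfs0 big_geq.
rewrite big_nat_recr // -IHn -[edges (construction S n.+2)]/(
  edges (construction S n.+1) `|` _).
have disj :
    [disjoint edges (construction S n.+1) & [fset (s, n.+2) | s in S n.+2]].
  apply/fdisjointP => -[x y]; rewrite in_edges_construction => /andP[y_le _].
  by apply/imfsetP => /= -[s _ [_ yE]]; move: y_le; rewrite yE; lia.
move: disj; rewrite -leq_card_fsetU => /eqP->.
by rewrite card_imfset //= => a b [].
Qed.

(** * The queue of tree vertices *)

Lemma leq_prefix_sum f m n : m <= n -> prefix_sum f m <= prefix_sum f n.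
Proof.
by move=> /subnK<-; elim: (n - m) => // k IHk; rewrite addSn prefix_sumS; lia.
Qed.

Lemma prefix_sum_add_sub f g n :
    (forall k, 0 < k <= n -> g k <= f k) ->
  prefix_sum (fun k => f k - g k) n + prefix_sum g n = prefix_sum f n.
Proof.
elim: n => [|n IHn] gf; first by rewrite !prefix_sum0.
rewrite !prefix_sumS -IHn; last by move=> k k_n; apply: gf; lia.
by have := gf n.+1; rewrite leqnn => /(_ isT); lia.
Qed.

Definition window v N (p : nat -> nat) k := if v < k <= v + N then p k else 0.

Lemma prefix_sum_window v N p n :
  prefix_sum (window v N p) n =
  prefix_sum (fun k => p (v + k)) (minn (n - v) N).
Proof.
elim: n => [|n IHn]; first by rewrite sub0n min0n !prefix_sum0.
rewrite prefix_sumS IHn /window; case: ifP => n_win.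
  have -> : minn (n.+1 - v) N = (n - v).+1 by lia.
  have -> : minn (n - v) N = n - v by lia.
  by rewrite prefix_sumS; congr (_ + p _); lia.
by rewrite addn0; congr prefix_sum; lia.
Qed.

(** The j-th member, from 0, of the queue 1, ..., v, v+N, v+N+1, ...; in it v+N
    stands for the whole cycle. *)
Definition tree_vertex v N j := if j < v then j.+1 else j + N.

(** Consecutive intervals of the queue, so that no member is used twice. *)
Definition tree_in_neighbours v N (q : nat -> nat) i :=
  map (tree_vertex v N) (iota (prefix_sum q i.-1) (q i)).

Lemma tree_vertex_inj v N : 0 < N -> injective (tree_vertex v N).
Proof.
by move=> N0 a b; rewrite /tree_vertex; case: (ltnP a v); case: (ltnP b v); lia.
Qed.

Lemma tree_in_neighboursP v N q i x : 0 < i ->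
  reflect (exists2 j, prefix_sum q i.-1 <= j < prefix_sum q i
             & x = tree_vertex v N j)
          (x \in tree_in_neighbours v N q i).
Proof.
case: i => // i _; apply: (iffP mapP) => -[j].
  by rewrite mem_iota -prefix_sumS => j_in ->; exists j.
by rewrite prefix_sumS => j_in ->; exists j; rewrite ?mem_iota.
Qed.

Lemma tree_in_neighbours_disjoint v N q i i' x : 0 < N -> 0 < i -> 0 < i' ->
  x \in tree_in_neighbours v N q i -> x \in tree_in_neighbours v N q i' ->
  i = i'.
Proof.
move=> N0 i0 i'0 /(tree_in_neighboursP _ _ _ _ i0)[j j_i ->].
case/(tree_in_neighboursP _ _ _ _ i'0)=> [j' j_i' /(tree_vertex_inj N0) jj'].
case: (ltngtP i i') => // lt_ii'.
  by have := @leq_prefix_sum q i i'.-1; lia.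
by have := @leq_prefix_sum q i' i.-1; lia.
Qed.


Theorem proposition4p13 (M N v : nat) (p t : nat -> nat)
  (hN : 2 < N) (hNM : N < M) (hv : 1 <= v <= M - N)
  (hp : motzkin_partition N (fun k => p (v + k)))
  (ht : partition_into M t)
  (h1 : forall i, v + 1 <= i <= v + N -> p i <= t i)
  (h2 : forall i, 1 <= i <= M -> \sum_(1 <= k < i.+1) t k <= i)
  (h3 : forall i, 1 <= i < v + N -> \sum_(1 <= k < i.+1) t k < i) :
  exists S : nat -> {fset nat},
    (forall i, 1 < i <= M ->
       (forall s, s \in S i -> 1 <= s <= i - 1) /\ #|` S i| = t i) /\
    let D := construction S M in
    [/\ #|` vertices D| = M,
        #|` edges D| = M
      & exists c : seq nat,
          [/\ undirected_cycle D c,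
              size c = N,
              forall x, (x \in c) = (v + 1 <= x <= v + N)
            & forall c', undirected_cycle D c' -> same_cycle c c']].
Proof.
pose pw := window v N p; pose q k := t k - pw k.
pose E i := tree_in_neighbours v N q i; pose C i := cycle_in_neighbours v p N i.
pose S i := [fset x in E i ++ C i].
have N0 : 0 < N by lia.
have pw_le k : pw k <= t k.
  by rewrite /pw /window; case: ifP => // k_win; apply: h1; lia.
have q_sum n : prefix_sum q n + prefix_sum pw n = prefix_sum t n.
  exact: prefix_sum_add_sub.
have sum_p : prefix_sum (fun k => p (v + k)) N = N by case: hp.
have sum_pwE n :
    prefix_sum pw n = prefix_sum (fun k => p (v + k)) (minn (n - v) N).
  exact: prefix_sum_window.
have sum_pw0 n : n <= v -> prefix_sum pw n = 0.
  by move=> n_v; rewrite sum_pwE (_ : minn _ _ = 0) ?prefix_sum0 //; lia.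
have sum_pwN n : v + N <= n -> prefix_sum pw n = N.
  by move=> n_v; rewrite sum_pwE (_ : minn _ _ = N) //; lia.
(* Vertex i takes queue positions below the prefix sum of q at i. That sum is
   less than i up to v, at most v on the cycle vertices, and at most i - N
   beyond them. *)
have E_spec i x : 0 < i <= M -> x \in E i ->
    0 < x < i /\ ((x <= v) || (v + N <= x) && (v + N < i)).
  case/andP=> i0 iM /(tree_in_neighboursP _ _ _ _ i0)[j /andP[_ j_lt] ->].
  have j_i : prefix_sum q i + prefix_sum pw i <= i by rewrite q_sum h2 ?i0.
  have j_i' : i < v + N -> prefix_sum q i + prefix_sum pw i < i.
    by move=> i_lt; rewrite q_sum h3 ?i0.
  have [i_v|v_i] := leqP i v.
    move: j_i'; rewrite (sum_pw0 i) // /tree_vertex => j_i'.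
    by case: (ltnP j v) => j_v; lia.
  have [i_vN|vN_i] := leqP i (v + N); last first.
    move: j_i; rewrite (sum_pwN i) ?(ltnW vN_i) // /tree_vertex => j_i.
    by case: (ltnP j v) => j_v; lia.
  have q_i := leq_prefix_sum q i_vN.
  have q_vN : prefix_sum q (v + N) + N <= v + N.
    by rewrite -{2}(sum_pwN (v + N)) // q_sum h2; lia.
  by rewrite /tree_vertex; case: (ltnP j v) => j_v; lia.
have C_spec i : [/\ size (C i) = pw i, uniq (C i) &
    forall x, x \in C i -> v < x < i /\ i <= v + N].
  rewrite /C /cycle_in_neighbours /pw /window; case: ifP => // /andP[v_i i_vN].
  have k_lt : i - v.+1 < N by lia.
  have [-> -> j_sub] := attached_ends_spec hp hN k_lt.
  split=> //; first by congr p; lia.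
  by move=> x /j_sub; rewrite mem_iota; lia.
have C_lt x i : x \in C i -> v < x < i /\ i <= v + N.
  by case: (C_spec i) => _ _; apply.
have memS i x : (x \in S i) = (x \in E i) || (x \in C i).
  by rewrite in_fset -mem_cat.
have S_spec i s : 0 < i <= M -> s \in S i -> 0 < s < i.
  move=> iM; rewrite memS => /orP[/(E_spec _ _ iM)[] // |].
  by move=> /C_lt; lia.
have S_card i : 0 < i <= M -> #|` S i| = t i.
  move=> iM; have [sz_C uC C_sub] := C_spec i.
  rewrite card_fseq undup_id.
    by rewrite size_cat size_map size_iota sz_C subnK.
  rewrite cat_uniq uC andbT map_inj_uniq ?iota_uniq //=;
    last exact: tree_vertex_inj.
  by apply/hasPn => x /C_sub x_C; apply/negP => /(E_spec _ _ iM); lia.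
exists S; split.
  by move=> i iM; split=> [s /S_spec|]; [lia | apply: S_card; lia].
have sum_t : prefix_sum t M = M := ht.
split; first exact: card_vertices_construction.
  have EM : M = M.-1.+1 by lia.
  rewrite [in LHS]EM card_edges_construction -EM -[RHS]sum_t.
  rewrite /prefix_sum [RHS]big_ltn; last by lia.
  have -> : t 1 = 0.
    have := h3 1; rewrite big_nat1 => t1; apply/eqP; rewrite -leqn0 -ltnS.
    by apply: t1; lia.
  by apply: eq_big_nat => i i_M; apply: S_card; lia.
have [c [Uc sz_c mem_c Cc c_next]] := motzkin_cycle hp hN.
have adjE x y : adjacent (construction S M) x y =
    (1 < y <= M) && (x \in S y) || (1 < x <= M) && (y \in S x).
  by rewrite /adjacent !in_edges_construction.
exists c; split=> //.
  apply/and3P; split=> //; first by rewrite sz_c.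
  apply: sub_cycle Cc => x y xy; rewrite adjE !memS.
  case/orP: xy => xy; have xy_lt := C_lt _ _ xy.
    by rewrite xy orbT andbT; apply/orP; left; lia.
  by rewrite xy orbT andbT; apply/orP; right; lia.
move=> c' /and3P[sz_c' Uc' Cc'].
pose tree : rel nat := fun u i => (0 < i <= M) && (u \in E i).
pose block x := v < x <= v + N.
have {}Cc' : cycle (fun x y =>
    [&& adjacent (construction S M) x y, block x & block y]) c'.
  apply: (@cycle_in_block tree _ (v + N)) => //.
  - by move=> x i /andP[iM /(E_spec _ _ iM)]; lia.
  - move=> x i i' /andP[/andP[i0 _] xi] /andP[/andP[i'0 _] xi'].
    exact: tree_in_neighbours_disjoint xi xi'.
  - by move=> x; rewrite /block; lia.
  - by move=> x i x_b /andP[iM /(E_spec _ _ iM)]; rewrite /block in x_b; lia.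
  - move=> x y; rewrite adjE !memS /tree /block.
    have C_block u i : u \in C i -> (v < u <= v + N) && (v < i <= v + N).
      by move=> /C_lt; lia.
    case/orP=> /andP[yM /orP[-> | /C_block]]; lia.
apply: same_cycle_of_steps => //.
  move=> x x_c'; rewrite mem_c; have := next_cycle Cc' x_c'.
  by case/and3P=> _; rewrite /block; lia.
apply: sub_cycle Cc' => x y /and3P[]; rewrite adjE !memS => xy x_b y_b.
have no_tree u i : block u -> block i -> 0 < i <= M -> u \notin E i.
  move=> u_b i_b iM; apply/negP => /(E_spec _ _ iM).
  by rewrite /block in u_b i_b; lia.
case/orP: xy => /andP[iM]; rewrite (negbTE (no_tree _ _ _ _ _)) //=; try lia.
  exact: c_next.
by rewrite orbC; apply: c_next.
Qed.
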